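(* Let $n,k\in\mathbb{Z}$. If a complex-valued function $g=g(z,\bar z)$ of class $C^2$ is a solution of the system $$\partial\bar\partial g=2i\,e^{i(k-n)\pi}\left[(\bar\partial g)(\partial\bar g)^{1/2}(\partial g)^{1/2}+(\bar\partial g)^{1/2}(\partial g)(\bar\partial\bar g)^{1/2}\right],$$ $$\bar\partial\partial\bar g=-2i\,e^{-i(k-n)\pi}\left[(\partial\bar g)(\bar\partial g)^{1/2}(\bar\partial\bar g)^{1/2}+(\partial\bar g)^{1/2}(\bar\partial\bar g)(\partial g)^{1/2}\right],$$ then the complex-valued functions $\psi_1,\psi_2$ defined by $$\psi_1=e^{in\pi}(\bar\partial g)^{1/2},\qquad \psi_2=i\,e^{ik\pi}(\partial g)^{1/2},\qquad \bar\psi_1=e^{-in\pi}(\partial\bar g)^{1/2},\qquad \bar\psi_2=-i\,e^{-ik\pi}(\bar\partial\bar g)^{1/2}$$ are solutions of the Weierstrass–Enneper system $$\partial\psi_1=p\,\psi_2,\qquad \bar\partial\psi_2=-p\,\psi_1,\qquad \bar\partial\bar\psi_1=p\,\bar\psi_2,\qquad \partial\bar\psi_2=-p\,\bar\psi_1,\qquad p=|\psi_1|^2+|\psi_2|^2 .$$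
   Context: $\partial=\partial/\partial z$ and $\bar\partial=\partial/\partial\bar z$ are the derivatives with respect to the complex variable $z$ and its conjugate $\bar z$, and a bar over a function denotes complex conjugation.
   Formalization: It is additionally assumed that ∂g and ∂̄g vanish nowhere on the open domain, since g(z)=z solves the system but gives ψ1=0, |ψ2|=1, violating ∂ψ1=pψ2; the square roots are read as continuous branches. *)

(* Defs.v *)
From Stdlib Require Import Reals ZArith.
From Coquelicot Require Import Coquelicot.
Open Scope C_scope.

(* Total operators: they are the partial derivatives with respect to
   x = Re z and y = Im z wherever f is differentiable, which is stated
   separately with [class_C]. *)
Definition Cderx (f : C -> C) (z : C) : C :=
  (Derive (fun x => Re (f (x, Im z))) (Re z),
   Derive (fun x => Im (f (x, Im z))) (Re z)).

Definition Cdery (f : C -> C) (z : C) : C :=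
  (Derive (fun y => Re (f (Re z, y))) (Im z),
   Derive (fun y => Im (f (Re z, y))) (Im z)).

Definition dz (f : C -> C) (z : C) : C :=
  (Cderx f z - Ci * Cdery f z) / 2.

Definition dzbar (f : C -> C) (z : C) : C :=
  (Cderx f z + Ci * Cdery f z) / 2.

Definition conjf (f : C -> C) (z : C) : C := Cconj (f z).

(* Class C^m in the real sense, with respect to (x, y).  [ex_diff_n h m x y]
   says that the iterated partial derivatives of h of order at most m exist
   and are continuous at (x, y). *)
Definition class_C (m : nat) (Omega : C -> Prop) (f : C -> C) : Prop :=
  forall z : C, Omega z ->
    ex_diff_n (fun x y => Re (f (x, y))) m (Re z) (Im z) /\
    ex_diff_n (fun x y => Im (f (x, y))) m (Re z) (Im z).

Definition expi (t : R) : C := (cos t, sin t).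

(* f^(1/2) is read as any continuous branch, not necessarily the principal one,
   which is discontinuous on its cut. *)
Definition sqrt_branch (Omega : C -> Prop) (f s : C -> C) : Prop :=
  forall z : C, Omega z -> continuous s z /\ s z * s z = f z.

Definition WE_density (psi1 psi2 : C -> C) (z : C) : R :=
  (Cmod (psi1 z) ^ 2 + Cmod (psi2 z) ^ 2)%R.

Definition WE_solution (Omega : C -> Prop) (psi1 psi2 : C -> C) : Prop :=
  class_C 1 Omega psi1 /\ class_C 1 Omega psi2 /\
  forall z : C, Omega z ->
    let p : C := RtoC (WE_density psi1 psi2 z) in
    dz psi1 z = p * psi2 z /\
    dzbar psi2 z = - p * psi1 z /\
    dzbar (conjf psi1) z = p * conjf psi2 z /\
    dz (conjf psi2) z = - p * conjf psi1 z.

(* Main.v *)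
(* Since e^(i n pi) and e^(i k pi) square to 1, psi1 and psi2 are continuous
   square roots of dzbar g and -dz g, hence C^1 because these functions do not
   vanish.  In terms of psi1 and psi2 the equation for g reads
   dz (dzbar g) = 2 psi1 psi2 p.  Comparing with
   dz (psi1^2) = 2 psi1 (dz psi1) and, as the mixed derivatives commute,
   dzbar (psi2^2) = 2 psi2 (dzbar psi2) = - dz (dzbar g),
   one divides by 2 psi1 and 2 psi2. The other two equations are conjugates. *)

Require Import Defs.
From Stdlib Require Import Reals ZArith Lra Psatz.
From Coquelicot Require Import Coquelicot.
Open Scope C_scope.

(** * Slopes as limits, and square roots along a line *)

Lemma is_derive_slope (f : R -> R) (x l : R) :
  is_derive f x l <-> is_lim (fun y => (f y - f x) / (y - x))%R x l.
Proof.
  rewrite is_derive_Reals; split.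
  - intros Hf; apply is_lim_spec; intros eps.
    destruct (Hf eps (cond_pos eps)) as [d Hd].
    exists d; intros y Hy Hyx.
    replace (f y) with (f (x + (y - x)))%R by (f_equal; ring).
    apply Hd; [lra | exact Hy].
  - intros Hf eps Heps; apply is_lim_spec in Hf.
    destruct (Hf (mkposreal eps Heps)) as [d Hd].
    exists d; intros h Hh0 Hh.
    specialize (Hd (x + h)%R).
    replace (x + h - x)%R with h in Hd by ring.
    apply Hd; [|lra].
    change (Rabs (x + h - x) < d)%R.
    now replace (x + h - x)%R with h by ring.
Qed.

Lemma is_lim_continuous (f : R -> R) (x : R) :
  continuous f x -> is_lim f x (f x).
Proof.
  intros Hf; eapply filterlim_filter_le_1; [|exact Hf].
  apply filter_le_within.
Qed.

Lemma is_lim_mult_R (f h : R -> R) (x l m : R) :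
  is_lim f x l -> is_lim h x m -> is_lim (fun y => f y * h y)%R x (l * m)%R.
Proof. intros Hf Hh; exact (is_lim_mult f h x l m Hf Hh I). Qed.

Lemma is_lim_inv_R (f : R -> R) (x l : R) :
  is_lim f x l -> l <> 0%R -> is_lim (fun y => / f y)%R x (/ l)%R.
Proof.
  intros Hf Hl; apply (is_lim_inv f x l Hf).
  intros H; apply Hl; now injection H.
Qed.

(* From a - a0 + i (b - b0) = (s - s0) (s + s0) with s = u + i v, the slopes
   of u and v are those of a and b times factors continuous at x, since
   s + s0 tends to 2 s0 <> 0. *)
Lemma is_derive_sqrt_parts (a b u v : R -> R) (x a' b' : R) :
  continuous u x -> continuous v x ->
  locally x (fun y => u y * u y - v y * v y = a y /\ 2 * (u y * v y) = b y)%R ->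
  (u x * u x + v x * v x <> 0)%R ->
  is_derive a x a' -> is_derive b x b' ->
  is_derive u x
    ((a' * u x + b' * v x) * / (2 * (u x * u x + v x * v x)))%R /\
  is_derive v x
    ((b' * u x - a' * v x) * / (2 * (u x * u x + v x * v x)))%R.
Proof.
  intros Hu Hv Hab Hne Ha Hb.
  set (U := fun y => (u y + u x)%R); set (V := fun y => (v y + v x)%R).
  set (N := fun y => (U y * U y + V y * V y)%R).
  apply is_derive_slope in Ha; apply is_derive_slope in Hb.
  assert (HU : is_lim U x (u x + u x)%R).
  { apply is_lim_plus'; [now apply is_lim_continuous | apply is_lim_const]. }
  assert (HV : is_lim V x (v x + v x)%R).
  { apply is_lim_plus'; [now apply is_lim_continuous | apply is_lim_const]. }
  (* The limit of [N] at [x]: four times the quantity assumed nonzero. *)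
  set (n := ((u x + u x) * (u x + u x) + (v x + v x) * (v x + v x))%R).
  assert (Hn : n <> 0%R) by (unfold n; nra).
  assert (HN : is_lim N x n) by (apply is_lim_plus'; now apply is_lim_mult_R).
  assert (Habx := locally_singleton _ _ Hab); simpl in Habx.
  destruct Habx as [Hax Hbx].
  (* The quotient formulas for the slopes require [N y <> 0], [y <> x] and the relations to [a] and
     [b]; all three hold on a punctured neighbourhood of [x]. *)
  assert (HNne : Rbar_locally' x (fun y => N y <> 0%R)).
  { apply (HN (fun r => r <> 0%R)); now apply (open_neq 0%R). }
  assert (Hne' : Rbar_locally' x (fun y => y <> x)).
  { exists (mkposreal 1 Rlt_0_1); intros y _ Hy; exact Hy. }
  assert (Hab' : Rbar_locally' x (fun y => u y * u y - v y * v y = a y /\ 2 * (u y * v y) = b y)%R).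
  { now apply filter_le_within. }
  set (A := fun y => ((a y - a x) / (y - x))%R) in Ha.
  set (B := fun y => ((b y - b x) / (y - x))%R) in Hb.
  split; apply is_derive_slope.
  (* The complex slope of [u + i v] is $(A+iB)/(U+iV)$. Multiplying by the conjugate of the
     denominator gives this real part, and below the imaginary part $(BU-AV)/N$. *)
  - apply (is_lim_ext_loc (fun y => (A y * U y + B y * V y) * / N y)%R).
    + generalize (filter_and _ _ HNne (filter_and _ _ Hne' Hab')).
      apply filter_imp; intros y [H1 [H2 [H3 H4]]].
      unfold A, B; rewrite <- H3, <- H4, <- Hax, <- Hbx.
      unfold N, U, V in *; field; split; [exact (fun E => H2 (Rminus_diag_uniq _ _ E)) | exact H1].
    + replace ((a' * u x + b' * v x) * / (2 * (u x * u x + v x * v x)))%R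
        with ((a' * (u x + u x) + b' * (v x + v x)) * / n)%R
        by (unfold n in *; field; split; intros E; [apply Hne | apply Hn]; lra).
      apply is_lim_mult_R; [apply is_lim_plus'; now apply is_lim_mult_R | now apply is_lim_inv_R].
  - apply (is_lim_ext_loc (fun y => (B y * U y - A y * V y) * / N y)%R).
    + generalize (filter_and _ _ HNne (filter_and _ _ Hne' Hab')).
      apply filter_imp; intros y [H1 [H2 [H3 H4]]].
      unfold A, B; rewrite <- H3, <- H4, <- Hax, <- Hbx.
      unfold N, U, V in *; field; split; [exact (fun E => H2 (Rminus_diag_uniq _ _ E)) | exact H1].
    + replace ((b' * u x - a' * v x) * / (2 * (u x * u x + v x * v x)))%R
        with ((b' * (u x + u x) - a' * (v x + v x)) * / n)%R
        by (unfold n in *; field; split; intros E; [apply Hne | apply Hn]; lra).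
      apply is_lim_mult_R; [apply is_lim_minus'; now apply is_lim_mult_R | now apply is_lim_inv_R].
Qed.

(** * Real-valued C^1 functions on a plane set *)

Lemma continuous_hsection (z : C) : continuous (fun x : R => (x, Im z) : C) (Re z).
Proof.
  destruct z as [x y].
  apply filterlim_locally; intros eps; exists eps; intros t Ht.
  split; [exact Ht | apply ball_center].
Qed.

Lemma continuous_vsection (z : C) : continuous (fun y : R => (Re z, y) : C) (Im z).
Proof.
  destruct z as [x y].
  apply filterlim_locally; intros eps; exists eps; intros t Ht.
  split; [apply ball_center | exact Ht].
Qed.

(** The partial derivatives are explicit arguments, so that closed formulas for them can be carried
    along and compared. On an open set this is interchangeable with [ex_diff_n] of order 1. *)
Definition C1_on (Omega : C -> Prop) (P Px Py : C -> R) : Prop :=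
  forall z, Omega z ->
    is_derive (fun x => P (x, Im z)) (Re z) (Px z) /\
    is_derive (fun y => P (Re z, y)) (Im z) (Py z) /\
    continuous P z /\ continuous Px z /\ continuous Py z.

Lemma continuous_mult_R (f h : C -> R) (z : C) :
  continuous f z -> continuous h z -> continuous (fun w => f w * h w)%R z.
Proof. exact (continuous_mult f h z). Qed.

Lemma continuous_plus_R (f h : C -> R) (z : C) :
  continuous f z -> continuous h z -> continuous (fun w => f w + h w)%R z.
Proof. exact (continuous_plus f h z). Qed.

Lemma C1_on_lincomb (Omega : C -> Prop) (c d : R) (P Px Py Q Qx Qy : C -> R) :
  C1_on Omega P Px Py -> C1_on Omega Q Qx Qy ->
  C1_on Omega (fun z => c * P z + d * Q z)%R
    (fun z => c * Px z + d * Qx z)%R (fun z => c * Py z + d * Qy z)%R.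
Proof.
  intros HP HQ z Hz.
  destruct (HP z Hz) as [P1 [P2 [P3 [P4 P5]]]].
  destruct (HQ z Hz) as [Q1 [Q2 [Q3 [Q4 Q5]]]].
  refine (conj _ (conj _ (conj _ (conj _ _)))).
  - apply (is_derive_plus (fun x => c * P (x, Im z))%R (fun x => d * Q (x, Im z))%R);
      apply is_derive_scal; assumption.
  - apply (is_derive_plus (fun y => c * P (Re z, y))%R (fun y => d * Q (Re z, y))%R);
      apply is_derive_scal; assumption.
  - apply continuous_plus_R; apply continuous_mult_R; try assumption; apply continuous_const.
  - apply continuous_plus_R; apply continuous_mult_R; try assumption; apply continuous_const.
  - apply continuous_plus_R; apply continuous_mult_R; try assumption; apply continuous_const.
Qed.

Lemma C1_on_ext (Omega : C -> Prop) (P Px Py Q Qx Qy : C -> R) :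
  (forall z, P z = Q z) -> (forall z, Px z = Qx z) -> (forall z, Py z = Qy z) ->
  C1_on Omega Q Qx Qy -> C1_on Omega P Px Py.
Proof.
  intros E Ex Ey HQ z Hz; destruct (HQ z Hz) as [Q1 [Q2 [Q3 [Q4 Q5]]]].
  refine (conj _ (conj _ (conj _ (conj _ _)))).
  - rewrite Ex; apply (is_derive_ext (fun x => Q (x, Im z))); [now intros t | exact Q1].
  - rewrite Ey; apply (is_derive_ext (fun y => Q (Re z, y))); [now intros t | exact Q2].
  - now apply (continuous_ext Q).
  - now apply (continuous_ext Qx).
  - now apply (continuous_ext Qy).
Qed.

Lemma continuity_2d_pt_C (P : C -> R) (z : C) :
  continuity_2d_pt (fun x y => P (x, y)) (Re z) (Im z) <-> continuous P z.
Proof.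
  rewrite continuity_2d_pt_filterlim; destruct z as [x y]; simpl.
  split; apply filterlim_ext; now intros [s t].
Qed.

Lemma locally_2d_C (S : C -> Prop) (z : C) :
  locally z S -> locally_2d (fun x y => S (x, y)) (Re z) (Im z).
Proof.
  intros H; apply locally_2d_locally; destruct z as [x y]; simpl.
  eapply filter_imp; [|exact H]; now intros [s t].
Qed.

Lemma ex_diff_n_1_C1_on (Omega : C -> Prop) (P : C -> R) :
  (forall z, Omega z -> ex_diff_n (fun x y => P (x, y)) 1 (Re z) (Im z)) ->
  C1_on Omega P (fun z => Derive (fun x => P (x, Im z)) (Re z))
    (fun z => Derive (fun y => P (Re z, y)) (Im z)).
Proof.
  intros H z Hz; destruct (H z Hz) as [H1 [H2 [H3 [[H4 _] [H5 _]]]]].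
  refine (conj _ (conj _ (conj _ (conj _ _)))).
  - now apply Derive_correct.
  - now apply Derive_correct.
  - now apply continuity_2d_pt_C.
  - now apply (continuity_2d_pt_C (fun z => Derive (fun x => P (x, Im z)) (Re z))).
  - now apply (continuity_2d_pt_C (fun z => Derive (fun y => P (Re z, y)) (Im z))).
Qed.

(** [ex_diff_n] asks for continuity of the [Derive] functions, which are known to agree with [Px]
    and [Py] only on [Omega]; openness makes them agree near the point, and continuity transfers. *)
Lemma C1_on_ex_diff_n_1 (Omega : C -> Prop) (P Px Py : C -> R) :
  open Omega -> C1_on Omega P Px Py ->
  forall z, Omega z -> ex_diff_n (fun x y => P (x, y)) 1 (Re z) (Im z).
Proof.
  intros HO H z Hz.
  assert (HL := locally_2d_C _ _ (HO z Hz)).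
  destruct (H z Hz) as [H1 [H2 [H3 [H4 H5]]]].
  refine (conj _ (conj _ (conj _ (conj (conj _ I) (conj _ I))))).
  - now apply continuity_2d_pt_C.
  - now exists (Px z).
  - now exists (Py z).
  - apply (continuity_2d_pt_ext_loc (fun x y => Px (x, y))).
    + eapply locally_2d_impl; [|exact HL]; apply locally_2d_forall.
      intros u v Huv; symmetry; apply is_derive_unique, (H (u, v) Huv).
    + now apply continuity_2d_pt_C.
  - apply (continuity_2d_pt_ext_loc (fun x y => Py (x, y))).
    + eapply locally_2d_impl; [|exact HL]; apply locally_2d_forall.
      intros u v Huv; symmetry; apply is_derive_unique, (H (u, v) Huv).
    + now apply continuity_2d_pt_C.
Qed.

(** * Complex-valued C^1 functions and their square roots *)

Lemma continuous_Re (s : C -> C) (z : C) :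
  continuous s z -> continuous (fun w => Re (s w)) z.
Proof.
  intros H; apply (continuous_comp s (fst : C -> R)); [exact H|].
  destruct (s z); apply continuous_fst.
Qed.

Lemma continuous_Im (s : C -> C) (z : C) :
  continuous s z -> continuous (fun w => Im (s w)) z.
Proof.
  intros H; apply (continuous_comp s (snd : C -> R)); [exact H|].
  destruct (s z); apply continuous_snd.
Qed.

Definition C1_on_C (Omega : C -> Prop) (f fx fy : C -> C) : Prop :=
  C1_on Omega (fun z => Re (f z)) (fun z => Re (fx z)) (fun z => Re (fy z)) /\
  C1_on Omega (fun z => Im (f z)) (fun z => Im (fx z)) (fun z => Im (fy z)).

Lemma C1_on_C_ext (Omega : C -> Prop) (f h hx hy : C -> C) :
  (forall z, f z = h z) -> C1_on_C Omega h hx hy -> C1_on_C Omega f hx hy.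
Proof.
  intros E [HR HI]; split.
  - refine (C1_on_ext _ _ _ _ _ _ _ _ _ _ HR); intros z; now rewrite ?E.
  - refine (C1_on_ext _ _ _ _ _ _ _ _ _ _ HI); intros z; now rewrite ?E.
Qed.

Lemma Re_Cmult (c w : C) : Re (c * w) = (Re c * Re w + - Im c * Im w)%R.
Proof. unfold Re, Im; simpl; ring. Qed.

Lemma Im_Cmult (c w : C) : Im (c * w) = (Im c * Re w + Re c * Im w)%R.
Proof. unfold Re, Im; simpl; ring. Qed.

Lemma C1_on_C_Cder (Omega : C -> Prop) (f fx fy : C -> C) :
  C1_on_C Omega f fx fy ->
  forall z, Omega z -> Cderx f z = fx z /\ Cdery f z = fy z.
Proof.
  intros [HR HI] z Hz.
  destruct (HR z Hz) as [R1 [R2 _]]; destruct (HI z Hz) as [I1 [I2 _]].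
  split; apply injective_projections; now apply is_derive_unique.
Qed.

(** On horizontal and vertical lines [is_derive_sqrt_parts] gives the partial derivatives of [s] as
    rational expressions in [s] and those of [h], with denominator $2|s|^2$. This is nonzero where
    [h] is, so these expressions are continuous. The second conclusion is the product rule for
    $s^2=h$, kept free of division. *)
Lemma sqrt_branch_C1 (Omega : C -> Prop) (h hx hy s : C -> C) :
  open Omega ->
  C1_on_C Omega h hx hy ->
  (forall z, Omega z -> h z <> 0) ->
  sqrt_branch Omega h s ->
  class_C 1 Omega s /\
  forall z, Omega z -> 2 * s z * Cderx s z = hx z /\ 2 * s z * Cdery s z = hy z.
Proof.
  intros HO [HR HI] Hne Hs.
  set (N := fun z => (Re (s z) * Re (s z) + Im (s z) * Im (s z))%R).
  (* [F d] and [G d] are the real and imaginary parts of $d/(2s)=d\,\bar s/(2|s|^2)$, with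
     $N=|s|^2$. *)
  set (F := fun (d : C -> C) z =>
    ((Re (d z) * Re (s z) + Im (d z) * Im (s z)) * / (2 * N z))%R).
  set (G := fun (d : C -> C) z =>
    ((Im (d z) * Re (s z) - Re (d z) * Im (s z)) * / (2 * N z))%R).
  assert (HN : forall z, Omega z -> N z <> 0%R).
  { intros z Hz H0; apply (Hne z Hz); destruct (Hs z Hz) as [_ <-].
    unfold N in H0; assert (Re (s z) = 0%R) by nra; assert (Im (s z) = 0%R) by nra.
    apply injective_projections; unfold Re, Im in *; simpl; nra. }
  assert (Hparts : forall w, Omega w ->
    (Re (s w) * Re (s w) - Im (s w) * Im (s w) = Re (h w) /\
     2 * (Re (s w) * Im (s w)) = Im (h w))%R).
  { intros w Hw; destruct (Hs w Hw) as [_ <-]; unfold Re, Im; simpl; split; ring. }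
  assert (HX : forall z, Omega z ->
    is_derive (fun x => Re (s (x, Im z))) (Re z) (F hx z) /\
    is_derive (fun x => Im (s (x, Im z))) (Re z) (G hx z)).
  { intros z Hz; destruct (HR z Hz) as [R1 _]; destruct (HI z Hz) as [I1 _].
    destruct (Hs z Hz) as [Hc _]; specialize (HN z Hz); specialize (HO z Hz).
    assert (Hsec := continuous_hsection z).
    destruct z as [x y]; simpl in *.
    apply (is_derive_sqrt_parts (fun t => Re (h (t, y))) (fun t => Im (h (t, y)))
      (fun t => Re (s (t, y))) (fun t => Im (s (t, y)))); try assumption.
    - apply (continuous_comp (fun t : R => (t, y) : C) (fun w => Re (s w)));
        [exact Hsec | now apply continuous_Re].
    - apply (continuous_comp (fun t : R => (t, y) : C) (fun w => Im (s w)));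
        [exact Hsec | now apply continuous_Im].
    (* Since [Omega] is open, the horizontal line through the point stays in it nearby, so $s^2=h$
       holds along that line near the point. *)
    - apply (filter_imp (fun t => Omega (t, y))); [intros t; apply Hparts | exact (Hsec _ HO)]. }
  assert (HY : forall z, Omega z ->
    is_derive (fun y => Re (s (Re z, y))) (Im z) (F hy z) /\
    is_derive (fun y => Im (s (Re z, y))) (Im z) (G hy z)).
  { intros z Hz; destruct (HR z Hz) as [_ [R1 _]]; destruct (HI z Hz) as [_ [I1 _]].
    destruct (Hs z Hz) as [Hc _]; specialize (HN z Hz); specialize (HO z Hz).
    assert (Hsec := continuous_vsection z).
    destruct z as [x y]; simpl in *.
    apply (is_derive_sqrt_parts (fun t => Re (h (x, t))) (fun t => Im (h (x, t)))
      (fun t => Re (s (x, t))) (fun t => Im (s (x, t)))); try assumption.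
    - apply (continuous_comp (fun t : R => (x, t) : C) (fun w => Re (s w)));
        [exact Hsec | now apply continuous_Re].
    - apply (continuous_comp (fun t : R => (x, t) : C) (fun w => Im (s w)));
        [exact Hsec | now apply continuous_Im].
    - apply (filter_imp (fun t => Omega (x, t))); [intros t; apply Hparts | exact (Hsec _ HO)]. }
  assert (HF : forall d z, Omega z -> continuous (fun w => Re (d w)) z ->
    continuous (fun w => Im (d w)) z -> continuous (F d) z /\ continuous (G d) z).
  { intros d z Hz D1 D2.
    assert (S1 := continuous_Re _ _ (proj1 (Hs z Hz))).
    assert (S2 := continuous_Im _ _ (proj1 (Hs z Hz))).
    assert (HNi : continuous (fun w => / (2 * N w))%R z).
    { apply (continuous_comp (fun w => 2 * N w)%R Rinv).
      - apply continuous_mult_R; [apply continuous_const|].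
        apply continuous_plus_R; now apply continuous_mult_R.
      - apply continuous_Rinv; specialize (HN z Hz); lra. }
    split; apply continuous_mult_R; try assumption.
    - apply continuous_plus_R; now apply continuous_mult_R.
    - apply (continuous_minus (fun w => Im (d w) * Re (s w))%R
        (fun w => Re (d w) * Im (s w))%R); now apply continuous_mult_R. }
  assert (CR : C1_on Omega (fun z => Re (s z)) (F hx) (F hy)).
  { intros z Hz; destruct (HR z Hz) as [_ [_ [_ [R4 R5]]]].
    destruct (HI z Hz) as [_ [_ [_ [I4 I5]]]].
    refine (conj _ (conj _ (conj _ (conj _ _)))); try apply HX; try apply HY; try assumption.
    - now apply continuous_Re, Hs.
    - now apply HF.
    - now apply HF. }
  assert (CI : C1_on Omega (fun z => Im (s z)) (G hx) (G hy)).
  { intros z Hz; destruct (HR z Hz) as [_ [_ [_ [R4 R5]]]].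
    destruct (HI z Hz) as [_ [_ [_ [I4 I5]]]].
    refine (conj _ (conj _ (conj _ (conj _ _)))); try apply HX; try apply HY; try assumption.
    - now apply continuous_Im, Hs.
    - now apply HF.
    - now apply HF. }
  split.
  - intros z Hz; split.
    + exact (C1_on_ex_diff_n_1 _ _ _ _ HO CR z Hz).
    + exact (C1_on_ex_diff_n_1 _ _ _ _ HO CI z Hz).
  - intros z Hz.
    destruct (C1_on_C_Cder Omega s (fun z => (F hx z, G hx z)) (fun z => (F hy z, G hy z))
      (conj CR CI) z Hz) as [-> ->].
    specialize (HN z Hz).
    split; apply injective_projections; unfold F, G, N, Re, Im in *; simpl; field; exact HN.
Qed.

(** * Linear combinations and second derivatives *)

Lemma C1_on_Cmult (Omega : C -> Prop) (c : C) (f fx fy : C -> C) :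
  C1_on_C Omega f fx fy ->
  C1_on_C Omega (fun z => c * f z) (fun z => c * fx z) (fun z => c * fy z).
Proof.
  intros [HR HI]; split.
  - apply (C1_on_ext Omega _ _ _ _ _ _ (fun z => Re_Cmult c (f z)) (fun z => Re_Cmult c (fx z))
      (fun z => Re_Cmult c (fy z))).
    now apply C1_on_lincomb.
  - apply (C1_on_ext Omega _ _ _ _ _ _ (fun z => Im_Cmult c (f z)) (fun z => Im_Cmult c (fx z))
      (fun z => Im_Cmult c (fy z))).
    now apply C1_on_lincomb.
Qed.

Lemma C1_on_Cplus (Omega : C -> Prop) (f fx fy h hx hy : C -> C) :
  C1_on_C Omega f fx fy -> C1_on_C Omega h hx hy ->
  C1_on_C Omega (fun z => f z + h z) (fun z => fx z + hx z) (fun z => fy z + hy z).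
Proof.
  assert (E : forall a b : R, (a + b = 1 * a + 1 * b)%R) by (intros; ring).
  intros [FR FI] [HR HI]; split.
  - apply (C1_on_ext Omega _ _ _ _ _ _ (fun z => E (Re (f z)) (Re (h z)))
      (fun z => E (Re (fx z)) (Re (hx z))) (fun z => E (Re (fy z)) (Re (hy z)))).
    now apply C1_on_lincomb.
  - apply (C1_on_ext Omega _ _ _ _ _ _ (fun z => E (Im (f z)) (Im (h z)))
      (fun z => E (Im (fx z)) (Im (hx z))) (fun z => E (Im (fy z)) (Im (hy z)))).
    now apply C1_on_lincomb.
Qed.

(** By its recursive definition, [ex_diff_n] at order 2 contains order 1 for both first partial
    derivatives. *)
Lemma class_C_2_C1_on (Omega : C -> Prop) (g : C -> C) :
  class_C 2 Omega g ->
  C1_on_C Omega (Cderx g) (Cderx (Cderx g)) (Cdery (Cderx g)) /\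
  C1_on_C Omega (Cdery g) (Cderx (Cdery g)) (Cdery (Cdery g)).
Proof.
  intros Hg; split; split.
  - apply (ex_diff_n_1_C1_on Omega (fun z => Re (Cderx g z))).
    intros z Hz; apply (Hg z Hz).
  - apply (ex_diff_n_1_C1_on Omega (fun z => Im (Cderx g z))).
    intros z Hz; apply (Hg z Hz).
  - apply (ex_diff_n_1_C1_on Omega (fun z => Re (Cdery g z))).
    intros z Hz; apply (Hg z Hz).
  - apply (ex_diff_n_1_C1_on Omega (fun z => Im (Cdery g z))).
    intros z Hz; apply (Hg z Hz).
Qed.

(** Schwarz's theorem wants the mixed derivatives to exist near the point and to be continuous at
    it; both are components of [ex_diff_n] at order 2. *)
Lemma ex_diff_n_2_Schwarz (f : R -> R -> R) (x y : R) :
  locally_2d (ex_diff_n f 2) x y ->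
  Derive (fun z => Derive (fun t => f z t) y) x =
  Derive (fun z => Derive (fun t => f t z) x) y.
Proof.
  intros H; apply Schwarz.
  - eapply locally_2d_impl; [|exact H]; apply locally_2d_forall.
    (* [H3] differentiates the x-derivative in y, and [H4] the y-derivative in x. *)
    intros u v [_ [H1 [H2 [[_ [_ [H3 _]]] [_ [H4 _]]]]]]; now repeat split.
  - now destruct (locally_2d_singleton _ _ _ H) as [_ [_ [_ [_ [_ [_ [_ [[K _] _]]]]]]]].
  - now destruct (locally_2d_singleton _ _ _ H) as [_ [_ [_ [[_ [_ [_ [_ [K _]]]]] _]]]].
Qed.

Lemma Cderx_Cdery_comm (Omega : C -> Prop) (g : C -> C) :
  open Omega -> class_C 2 Omega g ->
  forall z, Omega z -> Cderx (Cdery g) z = Cdery (Cderx g) z.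
Proof.
  intros HO Hg z Hz; assert (HL := locally_2d_C _ _ (HO z Hz)).
  assert (SR : locally_2d (ex_diff_n (fun x y => Re (g (x, y))) 2) (Re z) (Im z)).
  { eapply locally_2d_impl; [|exact HL]; apply locally_2d_forall.
    intros u v Huv; apply (Hg (u, v) Huv). }
  assert (SI : locally_2d (ex_diff_n (fun x y => Im (g (x, y))) 2) (Re z) (Im z)).
  { eapply locally_2d_impl; [|exact HL]; apply locally_2d_forall.
    intros u v Huv; apply (Hg (u, v) Huv). }
  apply ex_diff_n_2_Schwarz in SR; apply ex_diff_n_2_Schwarz in SI.
  destruct z as [x y]; unfold Cderx, Cdery, Re, Im in *; simpl in *.
  now rewrite SR, SI.
Qed.

(** * Conjugation *)

Lemma Cderx_conjf (f : C -> C) (z : C) : Cderx (conjf f) z = Cconj (Cderx f z).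
Proof.
  apply injective_projections; [reflexivity|].
  exact (Derive_opp (fun x => Im (f (x, Im z))) (Re z)).
Qed.

Lemma Cdery_conjf (f : C -> C) (z : C) : Cdery (conjf f) z = Cconj (Cdery f z).
Proof.
  apply injective_projections; [reflexivity|].
  exact (Derive_opp (fun y => Im (f (Re z, y))) (Im z)).
Qed.

(** Conjugation commutes with the real partial derivatives and flips the sign of [Ci], which
    exchanges [dz] and [dzbar]. *)
Lemma dzbar_conjf (f : C -> C) (z : C) : dzbar (conjf f) z = Cconj (dz f z).
Proof.
  unfold dzbar, dz; rewrite Cderx_conjf, Cdery_conjf.
  apply injective_projections; simpl; field.
Qed.

Lemma dz_conjf (f : C -> C) (z : C) : dz (conjf f) z = Cconj (dzbar f z).
Proof.
  unfold dzbar, dz; rewrite Cderx_conjf, Cdery_conjf.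
  apply injective_projections; simpl; field.
Qed.

(** * Constant factors and phases *)

Lemma continuous_Cmult_l (c : C) (s : C -> C) (z : C) :
  continuous s z -> continuous (fun w => c * s w) z.
Proof.
  intros Hs.
  assert (H1 := continuous_Re _ _ Hs); assert (H2 := continuous_Im _ _ Hs).
  apply filterlim_locally; intros eps.
  assert (HR : continuous (fun w => Re c * Re (s w) + - Im c * Im (s w))%R z)
    by (apply continuous_plus_R; apply continuous_mult_R; try assumption; apply continuous_const).
  assert (HI : continuous (fun w => Im c * Re (s w) + Re c * Im (s w))%R z)
    by (apply continuous_plus_R; apply continuous_mult_R; try assumption; apply continuous_const).
  assert (KR := proj1 (filterlim_locally _ _) HR eps).
  assert (KI := proj1 (filterlim_locally _ _) HI eps).
  generalize (filter_and _ _ KR KI); apply filter_imp; intros w [A B].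
  rewrite <- !Re_Cmult in A; rewrite <- !Im_Cmult in B; now split.
Qed.

(** Meant for [psi1] and [psi2], which are constant multiples of the given branches on [Omega] only;
    openness carries continuity over from [c * s]. *)
Lemma sqrt_branch_Cmult (Omega : C -> Prop) (c : C) (h s t : C -> C) :
  open Omega -> sqrt_branch Omega h s -> (forall z, Omega z -> t z = c * s z) ->
  sqrt_branch Omega (fun z => c * c * h z) t.
Proof.
  intros HO Hs Ht z Hz; destruct (Hs z Hz) as [Hc Hsq]; split.
  - apply (continuous_ext_loc t (fun w => c * s w)).
    + apply (filter_imp Omega); [intros w Hw; symmetry; now apply Ht | now apply HO].
    + now apply continuous_Cmult_l.
  - rewrite Ht, <- Hsq by assumption; ring.
Qed.

(** The sine vanishes at integer multiples of $\pi$, so these phases are real. This is what makes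
    them square to 1 and lets a difference of integers give a product of phases. *)
Lemma expi_opp_IZR_PI (m : Z) : expi (- (IZR m * PI)) = expi (IZR m * PI).
Proof.
  unfold expi; rewrite cos_neg, sin_neg, sin_eq_0_1; [now rewrite Ropp_0 | now exists m].
Qed.

Lemma expi_plus (s t : R) : expi (s + t) = expi s * expi t.
Proof.
  unfold expi; rewrite cos_plus, sin_plus; apply injective_projections; simpl; ring.
Qed.

Lemma expi_IZR_PI_sqr (m : Z) : expi (IZR m * PI) * expi (IZR m * PI) = 1.
Proof.
  rewrite <- expi_opp_IZR_PI at 1; rewrite <- expi_plus, Rplus_opp_l.
  unfold expi; now rewrite cos_0, sin_0.
Qed.

Lemma expi_IZR_PI_minus (k n : Z) :
  expi (IZR (k - n) * PI) = expi (IZR k * PI) * expi (IZR n * PI).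
Proof.
  rewrite <- (expi_opp_IZR_PI n), <- expi_plus, minus_IZR; f_equal; ring.
Qed.

Lemma Cmult_cancel_l (w a b : C) : w <> 0 -> w * a = w * b -> a = b.
Proof.
  intros Hw H.
  rewrite <- (Cmult_1_l a), <- (Cmult_1_l b), <- (Cinv_l w Hw), <- !Cmult_assoc.
  now rewrite H.
Qed.

(* ra, rb, rc, rd are the branches of (dzbar g)^(1/2), (dz g)^(1/2),
   (dz gbar)^(1/2), (dzbar gbar)^(1/2). *)
Theorem proposition2 (n k : Z) (Omega : C -> Prop) (g ra rb rc rd psi1 psi2 : C -> C)
  (Omega_open : open Omega)
  (g_C2 : class_C 2 Omega g)
  (dzbar_g_neq0 : forall z : C, Omega z -> dzbar g z <> 0)
  (dz_g_neq0 : forall z : C, Omega z -> dz g z <> 0)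
  (ra_sqrt : sqrt_branch Omega (dzbar g) ra)
  (rb_sqrt : sqrt_branch Omega (dz g) rb)
  (rc_sqrt : sqrt_branch Omega (dz (conjf g)) rc)
  (rd_sqrt : sqrt_branch Omega (dzbar (conjf g)) rd)
  (g_eq : forall z : C, Omega z ->
     dz (dzbar g) z =
     2 * Ci * expi (IZR (k - n) * PI) *
       (dzbar g z * rc z * rb z + ra z * dz g z * rd z))
  (gbar_eq : forall z : C, Omega z ->
     dzbar (dz (conjf g)) z =
     - (2) * Ci * expi (- (IZR (k - n) * PI)) *
       (dz (conjf g) z * ra z * rd z + rc z * dzbar (conjf g) z * rb z))
  (psi1_def : forall z : C, Omega z -> psi1 z = expi (IZR n * PI) * ra z)
  (psi2_def : forall z : C, Omega z -> psi2 z = Ci * expi (IZR k * PI) * rb z)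
  (psi1bar_def : forall z : C, Omega z ->
     conjf psi1 z = expi (- (IZR n * PI)) * rc z)
  (psi2bar_def : forall z : C, Omega z ->
     conjf psi2 z = - Ci * expi (- (IZR k * PI)) * rd z) :
  WE_solution Omega psi1 psi2.
Proof.
  assert (EE := expi_IZR_PI_sqr n); assert (FF := expi_IZR_PI_sqr k).
  assert (EF := expi_IZR_PI_minus k n).
  assert (EN := expi_opp_IZR_PI n); assert (FN := expi_opp_IZR_PI k).
  set (E := expi (IZR n * PI)) in *; set (F := expi (IZR k * PI)) in *.
  assert (II : Ci * Ci = -1) by (apply injective_projections; simpl; ring).
  assert (two : RtoC 2 <> 0) by (intros H; injection H; lra).
  (* The squares are $E^2\,\bar\partial g=\bar\partial g$ and $(iF)^2\,\partial g=-\partial g$. *)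
  assert (S1 := sqrt_branch_Cmult _ _ _ _ _ Omega_open ra_sqrt psi1_def).
  assert (S2 := sqrt_branch_Cmult _ _ _ _ _ Omega_open rb_sqrt psi2_def).
  destruct (class_C_2_C1_on _ _ g_C2) as [HX HY].
  assert (Hcomb : forall c d,
    C1_on_C Omega (fun z => c * Cderx g z + d * Cdery g z)
      (fun z => c * Cderx (Cderx g) z + d * Cderx (Cdery g) z)
      (fun z => c * Cdery (Cderx g) z + d * Cdery (Cdery g) z)).
  { intros c d; apply C1_on_Cplus; now apply C1_on_Cmult. }
  (* Written as linear combinations of the real partials, [dzbar g] and [dz g] inherit their C^1
     structure through [Hcomb]. *)
  assert (Hdzbar : forall z, dzbar g z = / 2 * Cderx g z + Ci / 2 * Cdery g z).
  { intros z; unfold dzbar; field; exact two. }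
  assert (Hdz : forall z, dz g z = / 2 * Cderx g z + - Ci / 2 * Cdery g z).
  { intros z; unfold dz; field; exact two. }
  assert (Ha := C1_on_C_ext _ _ _ _ _ Hdzbar (Hcomb (/ 2) (Ci / 2))).
  assert (Hb := C1_on_C_ext _ _ _ _ _ Hdz (Hcomb (/ 2) (- Ci / 2))).
  assert (N1 : forall z, Omega z -> E * E * dzbar g z <> 0).
  { intros z Hz; rewrite EE, Cmult_1_l; now apply dzbar_g_neq0. }
  assert (FI : Ci * F * (Ci * F) = -1).
  { replace (Ci * F * (Ci * F)) with (Ci * Ci * (F * F)) by ring.
    rewrite II, FF; ring. }
  assert (N2 : forall z, Omega z -> Ci * F * (Ci * F) * dz g z <> 0).
  { intros z Hz H0; apply (dz_g_neq0 z Hz); rewrite FI in H0.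
    replace (dz g z) with (- (-1 * dz g z)) by ring; rewrite H0; ring. }
  destruct (sqrt_branch_C1 _ _ _ _ _ Omega_open (C1_on_Cmult _ (E * E) _ _ _ Ha) N1 S1)
    as [C1 D1].
  destruct (sqrt_branch_C1 _ _ _ _ _ Omega_open (C1_on_Cmult _ _ _ _ _ Hb) N2 S2)
    as [C2 D2].
  split; [exact C1 | split; [exact C2 |]].
  intros z Hz p.
  rewrite dzbar_conjf, dz_conjf.
  destruct (D1 z Hz) as [D1x D1y]; destruct (D2 z Hz) as [D2x D2y].
  rewrite EE in D1x, D1y; rewrite FI in D2x, D2y.
  destruct (S1 z Hz) as [_ Q1]; destruct (S2 z Hz) as [_ Q2].
  rewrite EE in Q1; rewrite FI in Q2.
  assert (P1 : psi1 z <> 0).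
  { intros H0; apply (N1 z Hz); rewrite EE, <- Q1, H0; ring. }
  assert (P2 : psi2 z <> 0).
  { intros H0; apply (N2 z Hz); rewrite FI, <- Q2, H0; ring. }
  assert (N1' : 2 * psi1 z <> 0) by (apply Cmult_neq_0; assumption).
  assert (N2' : 2 * psi2 z <> 0) by (apply Cmult_neq_0; assumption).
  assert (Ep : p = psi1 z * Cconj (psi1 z) + psi2 z * Cconj (psi2 z)).
  { unfold p, WE_density; rewrite RtoC_plus, !Cmod2_conj; reflexivity. }
  (* The definitions are solved for the four roots, using $E^{-1}=E$ and $(iF)^{-1}=-iF$. *)
  assert (Era : ra z = E * psi1 z).
  { rewrite psi1_def, Cmult_assoc, EE by exact Hz; ring. }
  assert (Erb : rb z = - Ci * F * psi2 z).
  { rewrite psi2_def by exact Hz.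
    replace (- Ci * F * (Ci * F * rb z)) with (- (Ci * F * (Ci * F)) * rb z) by ring.
    rewrite FI; ring. }
  assert (Erc : rc z = E * Cconj (psi1 z)).
  { change (Cconj (psi1 z)) with (conjf psi1 z).
    rewrite psi1bar_def, EN, Cmult_assoc, EE by exact Hz; ring. }
  assert (Erd : rd z = Ci * F * Cconj (psi2 z)).
  { change (Cconj (psi2 z)) with (conjf psi2 z).
    rewrite psi2bar_def, FN by exact Hz.
    replace (Ci * F * (- Ci * F * rd z)) with (- (Ci * F * (Ci * F)) * rd z) by ring.
    rewrite FI; ring. }
  assert (Eg : dz (dzbar g) z = 2 * psi1 z * psi2 z * p).
  { rewrite (g_eq z Hz), EF, Era, Erb, Erc, Erd, Ep.
    replace (dzbar g z) with (psi1 z * psi1 z) by (rewrite Q1; ring).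
    replace (dz g z) with (- (psi2 z * psi2 z)) by (rewrite Q2; ring).
    (* All phases collect into the factor $-i^2E^2F^2=1$. *)
    transitivity (- (Ci * Ci) * (E * E) * (F * F) * (2 * psi1 z * psi2 z *
      (psi1 z * Cconj (psi1 z) + psi2 z * Cconj (psi2 z)))); [ring|].
    rewrite II, EE, FF; ring. }
  (* With the mixed derivative always written as [Cdery (Cderx g)], the expansions of
     $\partial\bar\partial g$ and $\bar\partial\partial g$ coincide. *)
  assert (Hsym := Cderx_Cdery_comm _ _ Omega_open g_C2 z Hz).
  unfold dz in Eg at 1.
  destruct (C1_on_C_Cder _ _ _ _ Ha z Hz) as [Ax Ay]; rewrite Ax, Ay, Hsym in Eg.
  rewrite Hsym in D1x, D2x.
  assert (R1 : dz psi1 z = p * psi2 z).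
  (* The factor [2 * psi1 z] turns the derivatives of [psi1] into those of its square, known from
     [D1x] and [D1y]. *)
  { assert (K : 2 * psi1 z * dz psi1 z = 2 * psi1 z * (p * psi2 z)).
    { transitivity (2 * psi1 z * psi2 z * p); [|ring].
      rewrite <- Eg; unfold dz.
      transitivity ((2 * psi1 z * Cderx psi1 z - Ci * (2 * psi1 z * Cdery psi1 z)) / 2);
        [field; exact two|].
      rewrite D1x, D1y; field; exact two. }
    apply (Cmult_cancel_l _ _ _ N1' K). }
  assert (R2 : dzbar psi2 z = - p * psi1 z).
  { assert (K : 2 * psi2 z * dzbar psi2 z = 2 * psi2 z * (- p * psi1 z)).
    (* The sign comes from $\psi_2^2=-\partial g$. *)
    { transitivity (- (2 * psi1 z * psi2 z * p)); [|ring].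
      rewrite <- Eg; unfold dzbar.
      transitivity ((2 * psi2 z * Cderx psi2 z + Ci * (2 * psi2 z * Cdery psi2 z)) / 2);
        [field; exact two|].
      rewrite D2x, D2y; field; exact two. }
    apply (Cmult_cancel_l _ _ _ N2' K). }
  (* As [p] is real, conjugating [R1] and [R2] yields the last two equations. *)
  rewrite R1, R2; unfold conjf, p.
  repeat split; apply injective_projections; simpl; ring.
Qed.
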